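(* There do not exist $p(x),q(x) \in \mathcal P$ with $q(x) \mid p(x)$ such that $22 = \frac{p(3)}{q(3)}$; that is, all representations of $22$ are local.
   Context: $\mathcal P$ denotes the set of Newman polynomials, i.e. polynomials with all coefficients in $\{0,1\}$ and constant term $1$ (including the constant polynomial $1$). A representation of an integer $m\equiv 1\pmod 3$ is an expression $m=\frac{p(3)}{q(3)}$ with $p(x),q(x)\in\mathcal P$. The representation is universal if $q(x)\mid p(x)$ (as polynomials), and local if $q(x)\nmid p(x)$. *)

(* Defs.v *)
From HB Require Import structures.
From mathcomp Require Import all_boot all_order all_algebra.
Set Implicit Arguments.
Unset Strict Implicit.
Unset Printing Implicit Defensive.
Import Order.TTheory GRing.Theory Num.Theory.
Local Open Scope ring_scope.

Definition newman (p : {poly int}) : Prop :=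
  (forall i : nat, p`_i = 0 \/ p`_i = 1) /\ p`_0 = 1.

(* The quotient is taken in rat; q.[3] >= 1 for every Newman polynomial q, so
   no division by zero occurs. *)
Definition representation (m : int) (p q : {poly int}) : Prop :=
  [/\ newman p, newman q & m%:Q = p.[3]%:Q / q.[3]%:Q].

(* Over int, [%|] is defined by pseudo-division; since a Newman polynomial q is
   monic, [q %| p] is exact divisibility in Z[x] (equivalently in Q[x]). *)
Definition universal_repr (m : int) (p q : {poly int}) : Prop :=
  representation m p q /\ q %| p.

Definition local_repr (m : int) (p q : {poly int}) : Prop :=
  representation m p q /\ ~~ (q %| p).

(* Main.v *)
Require Import Defs.
From HB Require Import structures.
From mathcomp Require Import all_boot all_order all_algebra.
From mathcomp Require Import zify.
Set Implicit Arguments.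
Unset Strict Implicit.
Unset Printing Implicit Defensive.
Import Order.TTheory GRing.Theory Num.Theory.
Local Open Scope ring_scope.

(** If [p.[3] = 22 * q.[3]] with [p], [q] Newman, comparing sizes at [3] gives
    [deg p <= deg q + 3], so a quotient [r = p / q] has degree at most [3].
    Reading the same equation modulo [81], with base-3 digits in [{0, 1}],
    forces [p = 1 + x] and [q = 1 + x^2 + x^3] modulo [x^4]. Hence
    [r = 1 + x - x^2 - 2 x^3], but then [r.[3] = -59], not [22]. *)

Lemma horner_trunc4 (R : comNzRingType) (p : {poly R}) (x : R) :
  p.[x] = p`_0 + p`_1 * x + p`_2 * x ^+ 2 + p`_3 * x ^+ 3
          + (drop_poly 4 p).[x] * x ^+ 4.
Proof.
rewrite -{1}(poly_take_drop 4 p) hornerD hornerM hornerXn; congr (_ + _).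
rewrite /take_poly horner_poly !big_ord_recr big_ord0 /=.
by rewrite expr0 expr1 add0r mulr1.
Qed.

Lemma newman_neq0 (p : {poly int}) : newman p -> p != 0.
Proof. by case=> _ p0; apply/eqP => pE; move: p0; rewrite pE coef0. Qed.

(** The leading coefficient is nonzero, hence 1, and all other terms are nonnegative at 3. *)
Lemma newman_horner3_ge (p : {poly int}) :
  newman p -> 3 ^+ (size p).-1 <= p.[3].
Proof.
move=> nwp; have p_neq0 := newman_neq0 nwp; case: nwp => p01 _.
have lc1 : p`_(size p).-1 = 1.
  have [lc0|//] := p01 (size p).-1.
  by move: p_neq0; rewrite -lead_coef_eq0 lead_coefE lc0.
rewrite horner_coef; move: lc1; case: (size p) (size_poly_eq0 p) => [|n] szp lc1.
  by move: p_neq0; rewrite -szp.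
rewrite big_ord_recr /= in lc1 *; rewrite lc1 mul1r lerDr.
apply: sumr_ge0 => i _; apply: mulr_ge0; last exact: exprn_ge0.
by case: (p01 i) => ->.
Qed.

(** The extreme case has all coefficients 1, with value [(3 ^+ size p - 1) / 2]. *)
Lemma newman_horner3_lt (p : {poly int}) :
  newman p -> 2 * p.[3] < 3 ^+ size p.
Proof.
case=> p01 _; rewrite horner_coef.
have step (S T b : int) :
    0 < T -> b = 0 \/ b = 1 -> 2 * S < T -> 2 * (S + b * T) < 3 * T.
  by move=> T_gt0 [] ->; lia.
elim: (size p) => [|n IHn]; first by rewrite big_ord0 mulr0 expr0.
by rewrite big_ord_recr exprS; apply: step => //; exact: exprn_gt0.
Qed.

Lemma representation_horner (m : int) (p q : {poly int}) :
  representation m p q -> p.[3] = m * q.[3].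
Proof.
case=> _ nwq mE.
have q3_neq0 : q.[3]%:Q != 0.
  rewrite intr_eq0 gt_eqF // (lt_le_trans _ (newman_horner3_ge nwq)) //.
  exact: exprn_gt0.
by apply: (intr_inj (R := rat)); rewrite intrM mE divfK.
Qed.

(** With n the size of [q], [p.[3] = 22 * q.[3] < 11 * 3 ^+ n < 3 ^+ (n + 3)], while [p.[3]] is at
    least 3 to the degree of [p]. *)
Lemma representation22_size (p q : {poly int}) :
  representation 22 p q -> (size p <= size q + 3)%N.
Proof.
move=> rep; have [nwp nwq _] := rep; have pqE := representation_horner rep.
have p_ge := newman_horner3_ge nwp; have q_lt := newman_horner3_lt nwq.
have : (3 : int) ^+ (size p).-1 < 3 ^+ (size q + 3).
  by rewrite exprD; lia.
by rewrite ltr_eXn2l //; lia.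
Qed.

(** Reduction modulo 9, 27 and 81 in turn gives [a1 = b1 + 1], [a2 = b2 + 2] and [a3 = b3 + 2]
    modulo 3; each congruence has a single solution with digits 0 and 1. *)
Lemma base3_digits22 (a1 a2 a3 A b1 b2 b3 B : int) :
  a1 = 0 \/ a1 = 1 -> a2 = 0 \/ a2 = 1 -> a3 = 0 \/ a3 = 1 ->
  b1 = 0 \/ b1 = 1 -> b2 = 0 \/ b2 = 1 -> b3 = 0 \/ b3 = 1 ->
  1 + a1 * 3 + a2 * 9 + a3 * 27 + A * 81 =
    22 * (1 + b1 * 3 + b2 * 9 + b3 * 27 + B * 81) ->
  [/\ a1 = 1, a2 = 0 & a3 = 0] /\ [/\ b1 = 0, b2 = 1 & b3 = 1].
Proof.
move=> a1_01 a2_01 a3_01 b1_01 b2_01 b3_01 eqn.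
have [a1E b1E] : a1 = 1 /\ b1 = 0.
  by case: a1_01 eqn => ->; case: b1_01 => -> eqn; split=> //; exfalso; lia.
subst a1 b1; have [a2E b2E] : a2 = 0 /\ b2 = 1.
  by case: a2_01 eqn => ->; case: b2_01 => -> eqn; split=> //; exfalso;
     case: a3_01 eqn => ->; case: b3_01 => -> eqn; lia.
subst a2 b2; have [a3E b3E] : a3 = 0 /\ b3 = 1.
  by case: a3_01 eqn => ->; case: b3_01 => -> eqn; split=> //; exfalso; lia.
by [].
Qed.

Lemma representation22_coef (p q : {poly int}) :
  representation 22 p q ->
  [/\ p`_0 = 1, p`_1 = 1, p`_2 = 0 & p`_3 = 0] /\
  [/\ q`_0 = 1, q`_1 = 0, q`_2 = 1 & q`_3 = 1].
Proof.
move=> rep; have [[p01 p0] [q01 q0] _] := rep.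
have := representation_horner rep; rewrite (horner_trunc4 p) (horner_trunc4 q) p0 q0.
by case/base3_digits22 => // -[-> -> ->] [-> -> ->].
Qed.

Lemma representation22_ndvdp (p q : {poly int}) :
  representation 22 p q -> ~~ (q %| p).
Proof.
move=> rep; apply/negP => q_dvd_p.
(* Divisibility over [int] is up to a nonzero scalar, so [r] is [c] times the quotient p / q. *)
have [c [r [c_neq0 cpE]]] :
    exists (c : int) (r : {poly int}), c != 0 /\ c *: p = r * q.
  by have /Pdiv.Idomain.dvdpP [[c r] /= c_neq0 cpE] := q_dvd_p; exists c, r.
have [nwp nwq _] := rep.
have [[p0 p1 p2 p3] [q0 q1 q2 q3]] := representation22_coef rep.
have coefE i : c * p`_i = \sum_(j < i.+1) r`_j * q`_(i - j).
  by rewrite -coefZ cpE coefM.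
(* These four equations give [r] the coefficients [c], [c], [- c], [- 2 * c]. *)
have := (coefE 0%N, coefE 1%N, coefE 2%N, coefE 3%N).
rewrite !big_ord_recr !big_ord0 /= !subn0 !subnn !subSS !subn0.
rewrite p0 p1 p2 p3 q0 q1 q2 q3 => -[[[r0E r1E] r2E] r3E].
have r_neq0 : r != 0.
  apply/eqP => rE; move: r0E; rewrite rE coef0; lia.
have sz_r : (size r <= 4)%N.
  have szp : size p = (size r + size q).-1.
    by rewrite -(size_scale p c_neq0) cpE (size_mul r_neq0 (newman_neq0 nwq)).
  have szq : (0 < size q)%N by rewrite size_poly_gt0 newman_neq0.
  have := representation22_size rep; rewrite szp.
  by move: (size r) (size q) szq => m n; lia.
have r3 : r.[3] = - 59 * c.
  (* The size bound removes the tail, leaving [c * (1 + 3 - 9 - 54)]. *)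
  rewrite horner_trunc4 drop_poly_eq0 // horner0 mul0r addr0.
  by move: r`_0 r`_1 r`_2 r`_3 r0E r1E r2E r3E => r0 r1 r2 r3; lia.
have q3_gt0 : 0 < q.[3].
  by rewrite (lt_le_trans _ (newman_horner3_ge nwq)) // exprn_gt0.
(* Evaluating at 3 and cancelling [q.[3]] leaves [c * 22 = - 59 * c], impossible for nonzero [c]. *)
have := congr1 (fun s => s.[3]) cpE.
rewrite hornerZ hornerM (representation_horner rep) r3 mulrA => /mulIf.
by move=> /(_ (lt0r_neq0 q3_gt0)); lia.
Qed.

Theorem theorem3p1 :
  (~ exists p q : {poly int}, universal_repr 22 p q) /\
  (forall p q : {poly int}, representation 22 p q -> local_repr 22 p q).
Proof.
split=> [[p [q [rep q_dvd_p]]]|p q rep].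
  by have := representation22_ndvdp rep; rewrite q_dvd_p.
by split=> //; exact: representation22_ndvdp.
Qed.
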